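(* Let $\Omega\subset\mathbb{R}^2$ be a bounded domain with smooth boundary, $I\in L^2(\Omega)$, $K$ a positive integer and $\lambda,\alpha,\varepsilon>0$. For every permutation $\sigma\in S_K$ and every $(P,U)\in\mathrm{adm}_K$, $$E[P_\sigma,U_\sigma\mid I]=E[P,U\mid I].$$ In particular, if $(P^*,U^* )\in\mathrm{adm}_K$ minimizes $E[\,\cdot\,,\cdot\mid I]$ over $\mathrm{adm}_K$, then for every $\sigma\in S_K$ the pair $(P^*_\sigma,U^*_\sigma)$ is also a minimizer of $E[\,\cdot\,,\cdot\mid I]$ over $\mathrm{adm}_K$.
   Context: A domain is a connected open set. $\Delta_{K-1}=\{(t_1,\dots,t_K)\in\mathbb{R}^K: t_i\ge 0,\ \sum_{i=1}^K t_i=1\}$ is the probability simplex. The admissible set is $$\mathrm{adm}_K=\{(P,U): P=(p_1,\dots,p_K),\ U=(u_1,\dots,u_K),\ p_i,u_i\in H^1(\Omega)\ (i=1,\dots,K),\ P(x)\in\Delta_{K-1}\text{ for a.e. }x\in\Omega\}.$$ All functions are real valued. The soft Mumford-Shah energy is $$E[P,U\mid I]=\lambda\sum_{i=1}^K\int_\Omega(u_i-I)^2p_i\,dx+\alpha\sum_{i=1}^K\int_\Omega|\nabla u_i|^2dx+\sum_{i=1}^K\int_\Omega\Big(9\varepsilon|\nabla p_i|^2+\frac{(p_i(1-p_i))^2}{\varepsilon}\Big)dx.$$ $S_K$ is the group of permutations of $\{1,\dots,K\}$, and for a $K$-tuple $F=(f_1,\dots,f_K)$ one sets $F_\sigma=(f_{\sigma(1)},\dots,f_{\sigma(K)})$.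 *)

(* Defs.v *)
From HB Require Import structures.
From mathcomp Require Import all_boot all_order all_algebra all_fingroup.
From mathcomp Require Import all_classical all_reals all_analysis.
Import Order.TTheory GRing.Theory Num.Theory.
Import numFieldNormedType.Exports.

Set Implicit Arguments.
Unset Strict Implicit.
Unset Printing Implicit Defensive.

Local Open Scope classical_set_scope.
Local Open Scope ring_scope.

Section Plane.
Variable R : realType.

(* Lebesgue measure of the plane [R * R]; [measurableTypeR R] is R with its
   Borel sigma-algebra. *)
Definition leb2 :
    {measure set (measurableTypeR R * measurableTypeR R) -> \bar R} :=
  (@lebesgue_measure R \x @lebesgue_measure R)%E.

Definition is_domain (Omega : set (R * R)) : Prop :=
  open Omega /\ connected Omega.

Definition smooth1 (g : R -> R) : Prop :=
  forall (n : nat) (x : R), derivable (derive1n n g) x 1.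

Definition reorient (swap flip : bool) (x : R * R) : R * R :=
  let y := if swap then (x.2, x.1) else x in (y.1, (-1) ^+ flip * y.2).

(* C^oo boundary: near each boundary point, after relabelling and reorienting
   the coordinate axes, Omega is the open region above the graph of a C^oo
   function. *)
Definition smooth_boundary (Omega : set (R * R)) : Prop :=
  forall x0 : R * R, (closure Omega `\` interior Omega) x0 ->
  exists (r : R) (swap flip : bool) (g : R -> R),
    [/\ 0 < r, smooth1 g &
        forall x : R * R, ball x0 r x ->
          (Omega x <->
           g (reorient swap flip x).1 < (reorient swap flip x).2)].

(* The two coordinate directions are indexed by [bool]. *)
Definition axis (j : bool) : R * R := if j then (0, 1) else (1, 0).

Definition partial (j : bool) (f : R * R -> R) : R * R -> R :=
  fun x => 'D_(axis j) f x.

Definition smooth2 (f : R * R -> R) : Prop :=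
  forall s : seq bool,
    let h := foldr partial f s in
    continuous h /\ forall (j : bool) (x : R * R), derivable h x (axis j).

Definition test_function (Omega : set (R * R)) (phi : R * R -> R) : Prop :=
  let S := closure [set x | phi x != 0] in
  [/\ smooth2 phi, compact S & S `<=` Omega].

(* Functions on Omega are represented by functions on the whole plane whose
   values outside Omega are irrelevant: [u \_ Omega] is the extension by 0. *)
Definition L2 (Omega : set (R * R)) (u : R * R -> R) : Prop :=
  (u \_ Omega) \in Lfun leb2 2%:E.

Definition weak_partial (Omega : set (R * R)) (j : bool)
    (u g : R * R -> R) : Prop :=
  forall phi : R * R -> R, test_function Omega phi ->
    \int[leb2]_(x in Omega) (u x * partial j phi x) =
    - \int[leb2]_(x in Omega) (g x * phi x).

Definition H1 (Omega : set (R * R)) (u : R * R -> R) : Prop :=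
  L2 Omega u /\
  forall j : bool, exists2 g : R * R -> R,
    L2 Omega g & weak_partial Omega j u g.

(* A representative of the j-th weak derivative of u; it is meaningful when
   [H1 Omega u] (see [wderivP]) and depends only on the a.e.-class of u. *)
Definition wderiv (Omega : set (R * R)) (j : bool) (u : R * R -> R) :
    R * R -> R :=
  xget (fun=> 0) [set g | L2 Omega g /\ weak_partial Omega j u g].

Lemma wderivP (Omega : set (R * R)) (j : bool) (u : R * R -> R) :
  H1 Omega u ->
  L2 Omega (wderiv Omega j u) /\ weak_partial Omega j u (wderiv Omega j u).
Proof.
case=> _ /(_ j) [g Lg wg].
exact: (@xgetPex _ (fun=> 0)
  [set g | L2 Omega g /\ weak_partial Omega j u g] (ex_intro _ g (conj Lg wg))).
Qed.

(* Squared Euclidean length of the weak gradient. *)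
Definition grad_sq (Omega : set (R * R)) (u : R * R -> R) (x : R * R) : R :=
  \sum_(j : bool) wderiv Omega j u x ^+ 2.

Definition simplex (K : nat) : set ('I_K -> R) :=
  [set t | (forall i, 0 <= t i) /\ \sum_(i < K) t i = 1].

Definition adm (Omega : set (R * R)) (K : nat)
    (P U : 'I_K -> R * R -> R) : Prop :=
  (forall i, H1 Omega (P i) /\ H1 Omega (U i)) /\
  {ae leb2, forall x, Omega x -> simplex (fun i => P i x)}.

(* The integrands are a.e. nonnegative when (P, U) is admissible. *)
Definition energy (Omega : set (R * R)) (K : nat) (lambda alpha eps : R)
    (I : R * R -> R) (P U : 'I_K -> R * R -> R) : \bar R :=
  (lambda%:E *
     (\sum_(i < K) \int[leb2]_(x in Omega) ((U i x - I x) ^+ 2 * P i x)%:E)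
   + alpha%:E *
     (\sum_(i < K) \int[leb2]_(x in Omega) (grad_sq Omega (U i) x)%:E)
   + \sum_(i < K) \int[leb2]_(x in Omega)
       (9 * eps * grad_sq Omega (P i) x
        + (P i x * (1 - P i x)) ^+ 2 / eps)%:E)%E.

Definition minimizer (Omega : set (R * R)) (K : nat) (lambda alpha eps : R)
    (I : R * R -> R) (P U : 'I_K -> R * R -> R) : Prop :=
  adm Omega P U /\
  forall Q V : 'I_K -> R * R -> R, adm Omega Q V ->
    (energy Omega lambda alpha eps I P U
       <= energy Omega lambda alpha eps I Q V)%E.

Definition permute (K : nat) (s : 'S_K) (F : 'I_K -> R * R -> R) :
    'I_K -> R * R -> R :=
  fun i => F (s i).

End Plane.

(* Main.v *)
Require Import Defs.
From mathcomp Require Import all_boot all_order all_algebra all_fingroup.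
From mathcomp Require Import all_classical all_reals all_analysis.
Import Order.TTheory GRing.Theory Num.Theory.
Import numFieldNormedType.Exports.
Local Open Scope classical_set_scope.
Local Open Scope ring_scope.

(** Each of the three terms of the energy is a finite sum over the labels of a
quantity that depends on one label only, and the group of permutations acts by
relabelling: it reindexes these sums bijectively and leaves their values
unchanged ([energy_permute]).  The simplex is symmetric in its coordinates, so
the admissible set is invariant under relabelling as well ([adm_permute]).  A
relabelled minimizer is thus an admissible pair whose energy is still the
minimum. *)

(** The sums of extended reals may be reindexed whatever the values of the
integrals: addition on [\bar R] is associative and commutative even when
infinite values of both signs occur. *)
Lemma energy_permute (R : realType) (Omega : set (R * R)) (K : nat)
    (lambda alpha eps : R) (I : R * R -> R) (s : 'S_K)
    (P U : 'I_K -> R * R -> R) :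
  energy Omega lambda alpha eps I (permute s P) (permute s U) =
  energy Omega lambda alpha eps I P U.
Proof.
have weighted_sums (a b : \bar R) (F G H : 'I_K -> \bar R) :
    (a * (\sum_(i < K) F (s i)) + b * (\sum_(i < K) G (s i))
       + \sum_(i < K) H (s i) =
     a * (\sum_(i < K) F i) + b * (\sum_(i < K) G i) + \sum_(i < K) H i)%E.
  have sum_permute (F' : 'I_K -> \bar R) :
      (\sum_(i < K) F' (s i) = \sum_(i < K) F' i)%E.
    by rewrite [RHS](reindex_inj (@perm_inj _ s)).
  by rewrite (sum_permute F) (sum_permute G) (sum_permute H).
exact: (weighted_sums lambda%:E alpha%:E
  (fun i => \int[leb2 R]_(x in Omega) ((U i x - I x) ^+ 2 * P i x)%:E)%E
  (fun i => \int[leb2 R]_(x in Omega) (grad_sq Omega (U i) x)%:E)%E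
  (fun i => \int[leb2 R]_(x in Omega)
     (9 * eps * grad_sq Omega (P i) x
      + (P i x * (1 - P i x)) ^+ 2 / eps)%:E)%E).
Qed.

Lemma simplex_permute (R : realType) (K : nat) (s : 'S_K) (t : 'I_K -> R) :
  simplex t -> simplex (fun i => t (s i)).
Proof.
move=> [t_ge0 sum_t]; split=> [i|]; first exact: t_ge0.
by rewrite -sum_t [RHS](reindex_inj (@perm_inj _ s)).
Qed.

Lemma adm_permute (R : realType) (Omega : set (R * R)) (K : nat) (s : 'S_K)
    (P U : 'I_K -> R * R -> R) :
  adm Omega P U -> adm Omega (permute s P) (permute s U).
Proof.
move=> [PU_H1 P_simplex]; split=> [i|]; first exact: PU_H1.
apply: (@filterS _ _ (ae_filter_ringOfSetsType (leb2 R)) _ _ _ P_simplex).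
by move=> x Px /Px; exact: simplex_permute.
Qed.

Theorem theorem2 (R : realType) (Omega : set (R * R)) (I : R * R -> R)
    (K : nat) (lambda alpha eps : R)
    (Omega_domain : is_domain Omega)
    (Omega_bounded : bounded_set Omega)
    (Omega_smooth : smooth_boundary Omega)
    (I_L2 : L2 Omega I)
    (K_gt0 : (0 < K)%N)
    (lambda_gt0 : 0 < lambda) (alpha_gt0 : 0 < alpha) (eps_gt0 : 0 < eps) :
  (forall (s : 'S_K) (P U : 'I_K -> R * R -> R), adm Omega P U ->
     energy Omega lambda alpha eps I (permute s P) (permute s U) =
     energy Omega lambda alpha eps I P U) /\
  (forall P U : 'I_K -> R * R -> R,
     minimizer Omega lambda alpha eps I P U ->
     forall s : 'S_K,
       minimizer Omega lambda alpha eps I (permute s P) (permute s U)).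
Proof.
split=> [s P U _|P U [PU_adm PU_min] s]; first exact: energy_permute.
split=> [|Q V QV_adm]; first exact: adm_permute.
by rewrite energy_permute; exact: PU_min.
Qed.
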